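(* Let $k$ be a positive integer and consider the $k$-th order system of two rational difference equations $$x_n=\frac{\alpha+\sum^{k}_{i=1}\beta_{i}x_{n-i} + \sum^{k}_{i=1}\gamma_{i}y_{n-i}}{A+\sum^{k}_{j=1}B_{j}x_{n-j} + \sum^{k}_{j=1}C_{j}y_{n-j}},\qquad y_n=\frac{p+\sum^{k}_{i=1}\delta_{i}x_{n-i} + \sum^{k}_{i=1}\epsilon_{i}y_{n-i}}{q+\sum^{k}_{j=1}D_{j}x_{n-j} + \sum^{k}_{j=1}E_{j}y_{n-j}},\qquad n\in\mathbb{N},$$ with non-negative real parameters and non-negative initial conditions. Assume that there exist constants $M_1,M_2>0$ such that every solution satisfies $M_1y_n\le x_n\le M_2y_n$ for all $n\in\mathbb{N}$. Suppose that $q=0$, $p=0$, and $I_\delta\cup I_\epsilon\subseteq I_D\cup I_E$. Then there exist $M>0$ and $N\in\mathbb{N}$ such that every solution (from any non-negative initial conditions) satisfies $x_n\le M$ and $y_n\le M$ for all $n>N$.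
   Context: $\mathbb{N}=\{1,2,\dots\}$. Initial conditions are $x_{1-k},\dots,x_0,y_{1-k},\dots,y_0\ge 0$; a solution is a pair of sequences generated by the system from non-negative initial conditions for which all denominators are positive for every $n\in\mathbb{N}$. Index sets in $\{1,\dots,k\}$: $I_\delta=\{i:\delta_i>0\}$, $I_\epsilon=\{i:\epsilon_i>0\}$, $I_D=\{j:D_j>0\}$, $I_E=\{j:E_j>0\}$. *)

(* Defs.v *)
From HB Require Import structures.
From mathcomp Require Import all_boot all_order all_algebra.
From mathcomp Require Import reals.
Set Implicit Arguments.
Unset Strict Implicit.
Unset Printing Implicit Defensive.
Import Order.TTheory GRing.Theory Num.Theory.
Local Open Scope ring_scope.

(* Coefficient families indexed by {1, ..., k} are functions on 'I_k: the
   element i : 'I_k stands for the index i.+1. Sequences with indices >= 1 - k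
   are functions on int, whose values at indices < 1 - k play no role. *)

(* c + \sum_{i=1}^k a_i x_{n-i} + \sum_{i=1}^k b_i y_{n-i} *)
Definition lag_form (R : realType) (k : nat) (c : R) (a b : 'I_k -> R)
    (x y : int -> R) (n : nat) : R :=
  c + \sum_(i < k) a i * x (n%:Z - i.+1%:Z)
    + \sum_(i < k) b i * y (n%:Z - i.+1%:Z).

Definition is_solution (R : realType) (k : nat)
    (alpha : R) (beta gamma : 'I_k -> R) (A : R) (B C : 'I_k -> R)
    (p : R) (delta epsilon : 'I_k -> R) (q : R) (D E : 'I_k -> R)
    (x y : int -> R) : Prop :=
  (forall m : int, 1 - k%:Z <= m <= 0 -> 0 <= x m /\ 0 <= y m) /\
  (forall n : nat, (1 <= n)%N ->
    [/\ 0 < lag_form A B C x y n,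
        0 < lag_form q D E x y n,
        x n%:Z = lag_form alpha beta gamma x y n / lag_form A B C x y n &
        y n%:Z = lag_form p delta epsilon x y n / lag_form q D E x y n]).

Definition pos_index (R : realType) (k : nat) (a : 'I_k -> R) : {set 'I_k} :=
  [set i | 0 < a i].

(* Main.v *)
(* Once n > k every lagged index is positive, so x and y are comparable there
   and, lag by lag, the numerator of y_n is at most a constant times the
   denominator: at a lag present in the numerator, the denominator dominates a
   positive multiple of y_(n-i) because of the inclusion of index sets. *)
Require Import Defs.
From HB Require Import structures.
From mathcomp Require Import all_boot all_order all_algebra.
From mathcomp Require Import reals zify lra.
Set Implicit Arguments.
Unset Strict Implicit.
Unset Printing Implicit Defensive.
Import Order.TTheory GRing.Theory Num.Theory.
Local Open Scope ring_scope.

Lemma lag_form_ge0 (R : realType) (k : nat) (c : R) (a b : 'I_k -> R)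
    (x y : int -> R) (n : nat) :
  0 <= c -> (forall i, 0 <= a i) -> (forall i, 0 <= b i) ->
  (forall i : 'I_k, 0 <= x (n%:Z - i.+1%:Z) /\ 0 <= y (n%:Z - i.+1%:Z)) ->
  0 <= lag_form c a b x y n.
Proof.
move=> c0 a0 b0 xy0; rewrite /lag_form !addr_ge0 //; apply: sumr_ge0 => i _;
  by have [? ?] := xy0 i; rewrite mulr_ge0.
Qed.

(** Each new term is a quotient of a combination of earlier terms with non-negative coefficients by
    a positive denominator, so the sign of the initial data propagates. *)
Lemma solution_ge0 (R : realType) (k : nat)
    (alpha : R) (beta gamma : 'I_k -> R) (A : R) (B C : 'I_k -> R)
    (p : R) (delta epsilon : 'I_k -> R) (q : R) (D E : 'I_k -> R)
    (x y : int -> R) :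
  0 <= alpha -> (forall i, 0 <= beta i) -> (forall i, 0 <= gamma i) ->
  0 <= p -> (forall i, 0 <= delta i) -> (forall i, 0 <= epsilon i) ->
  is_solution alpha beta gamma A B C p delta epsilon q D E x y ->
  forall m : int, 1 - k%:Z <= m -> 0 <= x m /\ 0 <= y m.
Proof.
move=> al0 be0 ga0 p0 de0 ep0 [init rec].
(* Bounding [m] above by a natural [n] allows induction on [n]: the hypothesis then covers the whole
   window of lags behind [n.+1], initial data included. *)
suff pos (n : nat) (m : int) : 1 - k%:Z <= m <= n%:Z -> 0 <= x m /\ 0 <= y m.
  by move=> m km; apply: (pos `|m|%N); lia.
elim: n m => [|n IHn] m /andP[km]; first by move=> m0; apply: init; rewrite km.
have [le_mn _|lt_nm le_mSn] := boolP (m <= n%:Z); first by apply: IHn; rewrite km.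
have -> : m = n.+1%:Z by lia.
have lag0 (i : 'I_k) :
    0 <= x (n.+1%:Z - i.+1%:Z) /\ 0 <= y (n.+1%:Z - i.+1%:Z).
  by apply: IHn; have := ltn_ord i; lia.
have [//|dx dy -> ->] := rec n.+1.
by split; apply: divr_ge0; rewrite ?(ltW dx) ?(ltW dy) // lag_form_ge0.
Qed.

Lemma lag_form_le (R : realType) (k : nat) (a b d e : 'I_k -> R) (K : R)
    (x y : int -> R) (n : nat) :
  (forall i : 'I_k,
     a i * x (n%:Z - i.+1%:Z) + b i * y (n%:Z - i.+1%:Z)
       <= K * (d i * x (n%:Z - i.+1%:Z) + e i * y (n%:Z - i.+1%:Z))) ->
  lag_form 0 a b x y n <= K * lag_form 0 d e x y n.
Proof.
move=> le_i; rewrite /lag_form !add0r -!big_split /= mulr_sumr.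
by apply: ler_sum => i _; exact: le_i.
Qed.

(** The constant comes from using [u <= M2 * v] in the numerator and [M1 * v <= u] in the
    denominator, which leaves a ratio of two multiples of [v]. *)
Lemma comparable_comb_le (R : realType) (a b d e M1 M2 u v : R) :
  0 <= a -> 0 <= b -> 0 <= d -> 0 <= e -> 0 < M1 -> 0 < M2 ->
  ((0 < a) || (0 < b) -> (0 < d) || (0 < e)) ->
  0 <= v -> M1 * v <= u -> u <= M2 * v ->
  a * u + b * v <= (a * M2 + b) / (d * M1 + e) * (d * u + e * v).
Proof.
move=> a0 b0 d0 e0 M1p M2p sub v0 le_u u_le.
have num_le : a * u + b * v <= (a * M2 + b) * v.
  by rewrite mulrDl -mulrA lerD2r ler_wpM2l.
have den_ge : (d * M1 + e) * v <= d * u + e * v.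
  by rewrite mulrDl -mulrA lerD2r ler_wpM2l.
have c0 : 0 <= d * M1 + e by rewrite addr_ge0 // mulr_ge0 // ltW.
have [cp|cz] := ltP 0 (d * M1 + e).
  apply: (le_trans num_le); rewrite mulrAC ler_pdivlMr // -mulrA.
  by rewrite ler_wpM2l 1?mulrC // addr_ge0 // mulr_ge0 // ltW.
(* Degenerate case: a vanishing [d * M1 + e] forces [d = e = 0], hence [a = b = 0] by [sub], and the
   claim becomes [0 <= 0]. *)
have dn : (0 < d) || (0 < e) = false.
  apply/negP => /orP[dp|ep].
    by have := mulr_gt0 dp M1p; lra.
  by have := mulr_ge0 d0 (ltW M1p); lra.
move: sub; rewrite dn !lt0r a0 b0 !andbT.
have [->|_] := eqVneq a 0; have [->|_] := eqVneq b 0 => /= sub;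
  try by have := sub isT.
by rewrite !mul0r addr0 !mul0r.
Qed.

Theorem theorem5 (R : realType) (k : nat) (k_gt0 : (0 < k)%N)
    (alpha : R) (beta gamma : 'I_k -> R) (A : R) (B C : 'I_k -> R)
    (p : R) (delta epsilon : 'I_k -> R) (q : R) (D E : 'I_k -> R)
    (const_ge0 : [/\ 0 <= alpha, 0 <= A, 0 <= p & 0 <= q])
    (x_coef_ge0 : forall i : 'I_k,
       [/\ 0 <= beta i, 0 <= gamma i, 0 <= B i & 0 <= C i])
    (y_coef_ge0 : forall i : 'I_k,
       [/\ 0 <= delta i, 0 <= epsilon i, 0 <= D i & 0 <= E i])
    (comparable_xy : exists M1 M2 : R, [/\ 0 < M1, 0 < M2 &
       forall x y : int -> R,
         is_solution alpha beta gamma A B C p delta epsilon q D E x y ->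
         forall n : nat, (1 <= n)%N ->
           M1 * y n%:Z <= x n%:Z /\ x n%:Z <= M2 * y n%:Z])
    (q_eq0 : q = 0) (p_eq0 : p = 0)
    (num_sub_den : pos_index delta :|: pos_index epsilon
                     \subset pos_index D :|: pos_index E) :
  exists (M : R) (N : nat), [/\ 0 < M, (1 <= N)%N &
    forall x y : int -> R,
      is_solution alpha beta gamma A B C p delta epsilon q D E x y ->
      forall n : nat, (N < n)%N -> x n%:Z <= M /\ y n%:Z <= M].
Proof.
have [al0 _ p0 _] := const_ge0.
have [M1 [M2 [M1p M2p cmp]]] := comparable_xy.
pose c i := (delta i * M2 + epsilon i) / (D i * M1 + E i).
have c0 i : 0 <= c i.
  have [? ? ? ?] := y_coef_ge0 i.
  by rewrite divr_ge0 // addr_ge0 // mulr_ge0 // ltW.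
(* One constant for all lags: the [c i] are non-negative, so their sum dominates each of them. *)
pose K := \sum_(i < k) c i.
have K0 : 0 <= K by apply: sumr_ge0.
have M2K0 : 0 <= M2 * K by rewrite mulr_ge0 // ltW.
(* [K] will bound [y] and [M2 * K] will bound [x]; the added 1 keeps the bound positive even when
   [K = 0]. Taking [N = k] puts every lagged index at 1 or later, where [cmp] applies. *)
exists (K + M2 * K + 1), k; split => [|//|x y sol n lt_kn]; first lra.
have n_gt0 : (1 <= n)%N by lia.
have xy0 : forall m : int, 1 - k%:Z <= m -> 0 <= x m /\ 0 <= y m.
  apply: (solution_ge0 _ _ _ _ _ _ sol) => // i;
    by [have [] := x_coef_ge0 i | have [] := y_coef_ge0 i].
have yK : y n%:Z <= K.
  have [_ /(_ n n_gt0)[_ den_gt0 _ ->]] := sol.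
  rewrite ler_pdivrMr //; move: den_gt0; rewrite q_eq0 p_eq0 => _.
  apply: lag_form_le => i; have [de0 ep0 D0 E0] := y_coef_ge0 i.
  (* Since [i.+1 <= k < n], the natural subtraction does not truncate, and the index gets the form
     required by [cmp]. *)
  have -> : n%:Z - i.+1%:Z = (n - i.+1)%N%:Z by have := ltn_ord i; lia.
  have lag_gt0 : (1 <= n - i.+1)%N by have := ltn_ord i; lia.
  have [le_x x_le] := cmp _ _ sol _ lag_gt0.
  have [x0 y0] : 0 <= x (n - i.+1)%N%:Z /\ 0 <= y (n - i.+1)%N%:Z.
    by apply: xy0; lia.
  have sub : (0 < delta i) || (0 < epsilon i) -> (0 < D i) || (0 < E i).
    by have /subsetP/(_ i) := num_sub_den; rewrite !inE.
  apply: (le_trans (comparable_comb_le de0 ep0 D0 E0 M1p M2p sub y0 le_x x_le)).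
  (* What remains is [c i <= K], multiplied by a non-negative denominator term. *)
  rewrite ler_wpM2r ?addr_ge0 ?mulr_ge0 // /K (bigD1 i) //= lerDl.
  exact: sumr_ge0.
have [_ xM] := cmp _ _ sol _ n_gt0.
have := ler_wpM2l (ltW M2p) yK.
by split; lra.
Qed.
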